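(* Consider an untolled mixed-autonomy routing instance with affine latencies $c_i(z_i)=\sum_{j\in[m]}a_i^j z_i^j+b_i$ on a general network, with maximum degree of asymmetry $k$. For any feasible equilibrium routing (Wardrop Equilibrium) $\hat z$ and any socially optimal routing $z^*$, $$C(\hat z)\le\Lambda(k)\,C(z^* ),\qquad\text{where}\quad \Lambda(k)=\begin{cases}4/(4-k), & k\le 3,\\ 4k/3, & k>3.\end{cases}$$
   Context: Network: a finite directed graph (parallel edges allowed) with $n$ edges (roads), indexed by $i\in[n]=\{1,\dots,n\}$; there are $m$ vehicle types indexed by $j\in[m]$. Flow is nonatomic. Demand is inelastic and given by finitely many commodities $r\in[R]$, each with a source node $s_r$, destination node $s'_r$, demand $\beta_r\ge 0$ and vehicle type $j_r\in[m]$; $\mathcal P_r$ is the set of simple paths from $s_r$ to $s'_r$. A feasible path flow assigns $f_{r,p}\ge0$ to each $r\in[R]$, $p\in\mathcal P_r$ with $\sum_{p\in\mathcal P_r}f_{r,p}=\beta_r$. It induces the edge routing $z=(z_i^j)$, where $z_i^j=\sum_{r:\,j_r=j}\ \sum_{p\in\mathcal P_r:\,i\in p}f_{r,p}$ is the flow of type $j$ on road $i$. Write $z_i=(z_i^1,\dots,z_i^m)^T$. The set $\mathcal Z$ of feasible routings is the set of edge routings induced by feasible path flows. Latency: on road $i$ all vehicle types experience the same latency $c_i(z_i)=\sum_{j\in[m]}a_i^jz_i^j+b_i$ with $a_i^j\ge0$, $b_i\ge0$. Social cost: $C(z)=\sum_{i\in[n]}\big(\sum_{j\in[m]}z_i^j\big)c_i(z_i)$.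 A socially optimal routing $z^*$ is a minimizer of $C$ over $\mathcal Z$. A feasible routing $z$ is a Wardrop Equilibrium (untolled) if it is induced by a feasible path flow $f$ such that for all $r\in[R]$ and all $p,p'\in\mathcal P_r$: $f_{r,p}>0$ implies $\sum_{i\in p}c_i(z_i)\le\sum_{i\in p'}c_i(z_i)$. The maximum degree of asymmetry is $k=\max_{i\in[n],\,j,j'\in[m]}a_i^j/a_i^{j'}$ (so $k\ge1$), assumed finite; on a road where all $a_i^j$ are zero the ratio is taken to be $1$. Thus $a_i^j\le k\,a_i^{j'}$ for all $i,j,j'$. *)

(* Defs.v *)
From HB Require Import structures.
From mathcomp Require Import all_boot all_order all_algebra.
From mathcomp Require Import constructive_ereal reals.

Set Implicit Arguments.
Unset Strict Implicit.
Unset Printing Implicit Defensive.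

Import Order.TTheory GRing.Theory Num.Theory.
Local Open Scope ring_scope.

(* [n] roads and [m] vehicle types, on a directed multigraph: road [i] goes
   from [tail_node i] to [head_node i], so parallel edges are allowed. *)
Record routing_instance (R : realType) (n m : nat) := RoutingInstance {
  node : finType;
  tail_node : 'I_n -> node;
  head_node : 'I_n -> node;
  ncom : nat;
  source : 'I_ncom -> node;
  target : 'I_ncom -> node;
  demand : 'I_ncom -> R;
  vtype : 'I_ncom -> 'I_m;
  slope : 'I_n -> 'I_m -> R;
  offset : 'I_n -> R;
  demand_ge0 : forall r, 0 <= demand r;
  slope_ge0 : forall i j, 0 <= slope i j;
  offset_ge0 : forall i, 0 <= offset i
}.

Section Routing.
Variables (R : realType) (n m : nat) (G : routing_instance R n m).

Fixpoint walk (s : node G) (p : seq 'I_n) (t : node G) : bool :=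
  if p is i :: p' then (tail_node G i == s) && walk (head_node G i) p' t else s == t.

(* Simple means that no node is repeated; in particular the empty path is the
   only simple path from a node to itself. *)
Definition simple_path (s t : node G) (p : seq 'I_n) : bool :=
  walk s p t && uniq (s :: map (head_node G) p).

(* A simple path does not repeat an edge, hence has length at most [n]: the
   finite type [n.-bseq 'I_n] contains all of them. *)
Definition com_paths (r : 'I_(ncom G)) : {set n.-bseq 'I_n} :=
  [set p : n.-bseq 'I_n | simple_path (source r) (target r) p].

(* Values of a path flow [f] at [p \notin com_paths r] are irrelevant. *)
Definition feasible_flow (f : 'I_(ncom G) -> n.-bseq 'I_n -> R) : Prop :=
  (forall r p, p \in com_paths r -> 0 <= f r p) /\
  (forall r, \sum_(p in com_paths r) f r p = demand r).

Definition edge_routing (f : 'I_(ncom G) -> n.-bseq 'I_n -> R) : 'M[R]_(n, m) :=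
  \matrix_(i, j)
    \sum_(r | vtype r == j) \sum_(p in com_paths r | i \in p) f r p.

Definition feasible_routing (z : 'M[R]_(n, m)) : Prop :=
  exists2 f, feasible_flow f & z = edge_routing f.

Definition latency (z : 'M[R]_(n, m)) (i : 'I_n) : R :=
  \sum_j slope G i j * z i j + offset G i.

Definition social_cost (z : 'M[R]_(n, m)) : R :=
  \sum_i (\sum_j z i j) * latency z i.

Definition socially_optimal (z : 'M[R]_(n, m)) : Prop :=
  feasible_routing z /\
  forall z', feasible_routing z' -> social_cost z <= social_cost z'.

Definition wardrop_equilibrium (z : 'M[R]_(n, m)) : Prop :=
  exists f, [/\ feasible_flow f, z = edge_routing f &
    forall r p p', p \in com_paths r -> p' \in com_paths r -> 0 < f r p ->
      \sum_(i <- p) latency z i <= \sum_(i <- p') latency z i].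

(* x / 0 is infinite for x > 0.  The value 1 for 0 / 0 only matters on roads
   all of whose slopes vanish: on any other road with a zero slope some other
   ratio is already infinite. *)
Definition asymmetry_ratio (i : 'I_n) (j j' : 'I_m) : \bar R :=
  if slope G i j' != 0 then (slope G i j / slope G i j')%:E
  else if slope G i j == 0 then 1%:E else +oo%E.

(* The base value 1 does not affect a nonempty maximum, since the ratio for
   j = j' is always 1; it only fixes the value when there is no road or no
   vehicle type. *)
Definition max_asymmetry : \bar R :=
  \big[maxe/1%:E]_(i < n) \big[maxe/1%:E]_(j < m) \big[maxe/1%:E]_(j' < m)
    asymmetry_ratio i j j'.

End Routing.

Definition Lambda (R : realType) (k : R) : R :=
  if k <= 3 then 4 / (4 - k) else 4 * k / 3.

(* Main.v *)
Require Import Defs.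
From HB Require Import structures.
From mathcomp Require Import all_boot all_order all_algebra.
From mathcomp Require Import constructive_ereal reals.
From mathcomp Require Import lra.

(** The equilibrium satisfies the variational inequality
    [C(zhat) <= \sum_i c_i(zhat) Z'_i], where [Z'_i] is the total flow of the
    optimum [zstar] on road [i] (and [Z_i] that of [zhat]).  On each road let
    [A], [A'] be the congestion parts of the latencies at [zhat], [zstar].
    Comparing slopes pairwise gives [A Z' <= k A' Z], hence
    [(A Z')^2 <= k (A' Z') (A Z)], and by AM-GM
    [A Z' <= l A' Z' + mu A Z] whenever [k <= 4 l mu].  With [l >= 1], summing
    over the roads gives [(1 - mu) C(zhat) <= l C(zstar)].  The choice
    [l = 1, mu = k/4] yields [4/(4-k)], and [l = k/2, mu = 1/2] yields [k],
    which is below [4k/3]. *)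

Set Implicit Arguments.
Unset Strict Implicit.
Unset Printing Implicit Defensive.

Import Order.TTheory GRing.Theory Num.Theory.
Local Open Scope ring_scope.

Section Routing.
Variables (R : realType) (n m : nat) (G : routing_instance R n m).

Lemma max_asymmetry_ge1 : (1%:E <= max_asymmetry G)%E.
Proof. exact: bigmax_ge_id. Qed.

Lemma asymmetry_ratio_le_max i j j' :
  (asymmetry_ratio G i j j' <= max_asymmetry G)%E.
Proof.
rewrite /max_asymmetry.
apply: le_trans (le_bigmax _ _ i); apply: le_trans (le_bigmax _ _ j).
exact: le_bigmax.
Qed.

Lemma slope_le_asymmetry k : max_asymmetry G = k%:E ->
  forall i j j', slope G i j <= k * slope G i j'.
Proof.
move=> hk i j j'; have := asymmetry_ratio_le_max i j j'.
rewrite hk /asymmetry_ratio; case: eqP => [->|/eqP nz] /=.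
  (* If [slope G i j'] is zero and [slope G i j] is not, the ratio is [+oo], which the finite [k]
     rules out. *)
  by case: eqP => [->|//]; rewrite mulr0.
by rewrite lee_fin ler_pdivrMr // lt_neqAle eq_sym nz slope_ge0.
Qed.

Lemma simple_path_uniq (s t : node G) p : simple_path s t p -> uniq p.
Proof. by case/andP=> _ /andP[_]; apply: map_uniq. Qed.

Lemma edge_routing_ge0 (f : 'I_(ncom G) -> n.-bseq 'I_n -> R) i j :
  feasible_flow f -> 0 <= edge_routing f i j.
Proof.
case=> f_ge0 _; rewrite mxE; apply: sumr_ge0 => r _.
by apply: sumr_ge0 => p /andP[pP _]; apply: f_ge0.
Qed.

(** Double counting: exchange the sums over roads and paths. A simple path repeats no road, so
    summing [c] along it counts each of its roads once. *)
Lemma sum_edge_routing (f : 'I_(ncom G) -> n.-bseq 'I_n -> R) (c : 'I_n -> R) :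
  \sum_i (\sum_j edge_routing f i j) * c i =
  \sum_r \sum_(p in com_paths r) f r p * \sum_(i <- p) c i.
Proof.
have total i : \sum_j edge_routing f i j =
    \sum_r \sum_(p in com_paths r | i \in p) f r p.
  rewrite [RHS](partition_big (@vtype _ _ _ G) predT) //=.
  by apply: eq_bigr => j _; rewrite mxE.
under eq_bigr do rewrite total mulr_suml.
rewrite exchange_big; apply: eq_bigr => r _ /=.
under eq_bigr do rewrite big_mkcondr mulr_suml.
rewrite exchange_big; apply: eq_bigr => p; rewrite inE => /simple_path_uniq Up.
rewrite mulr_sumr (big_uniq _ Up) /= [RHS]big_mkcond /=.
by apply: eq_bigr => i _; case: ifP => _; rewrite ?mul0r.
Qed.

(** With latencies frozen at [zhat], the equilibrium flow uses only cheapest paths. For each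
    commodity, demand times the least path latency thus separates the two sides. *)
Lemma wardrop_variational zhat z :
  wardrop_equilibrium G zhat -> feasible_routing G z ->
  social_cost G zhat <= \sum_i (\sum_j z i j) * latency G zhat i.
Proof.
case=> fhat [[fhat_ge0 fhat_dem] zhatE eq_fhat] [f [f_ge0 f_dem] ->].
rewrite /social_cost {1}zhatE !sum_edge_routing; apply: ler_sum => r _.
set L := fun p : n.-bseq 'I_n => \sum_(i <- p) latency G zhat i.
have [->|[p0 p0P]] := set_0Vmem (com_paths r); first by rewrite !big_set0.
case: (arg_minP L p0P) => q qP q_min.
apply: (@le_trans _ _ (demand r * L q)).
  rewrite -fhat_dem mulr_suml; apply: ler_sum => p pP.
  have := fhat_ge0 r p pP; rewrite le_eqVlt => /predU1P[<-|fp_gt0].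
    by rewrite !mul0r.
  by rewrite ler_pM2l //; apply: eq_fhat fp_gt0.
rewrite -f_dem mulr_suml; apply: ler_sum => p pP.
by apply: ler_wpM2l; [apply: f_ge0 | apply: q_min].
Qed.

End Routing.

(** Since [(l * p - mu * q) ^+ 2 >= 0], the square of [l * p + mu * q] is at least
    [4 * l * mu * p * q], hence at least [x ^+ 2]. *)
Lemma weighted_AMGM (R : realFieldType) (k l mu x p q : R) :
  0 <= l -> 0 <= mu -> k <= 4 * l * mu -> 0 <= p -> 0 <= q ->
  x ^+ 2 <= k * (p * q) -> x <= l * p + mu * q.
Proof.
move=> l0 mu0 hk p0 q0 hx; have pq0 := mulr_ge0 p0 q0.
have lp0 := mulr_ge0 l0 p0; have mq0 := mulr_ge0 mu0 q0.
have h := ler_wpM2r pq0 hk; have sq := sqr_ge0 (l * p - mu * q).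
rewrite leNgt; apply/negP => lt_x.
have : (l * p + mu * q) ^+ 2 < x ^+ 2 by rewrite ltr_pXn2r ?nnegrE //; lra.
nra.
Qed.

Lemma weighted_sum_sqr_le (R : realFieldType) (I : finType) (k : R)
    (a y z : I -> R) :
  (forall j, 0 <= a j) -> (forall j, 0 <= y j) ->
  (forall j, 0 <= z j) -> (forall j j', a j <= k * a j') ->
  ((\sum_j z j) * (\sum_j a j * y j)) ^+ 2 <=
  k * (((\sum_j z j) * (\sum_j a j * z j)) *
       ((\sum_j y j) * (\sum_j a j * y j))).
Proof.
move=> a0 y0 z0 hak.
(* Expanded into double sums, this holds term by term from [a j' <= k * a j]; multiplying it by its
   own left side gives the claim. *)
have cross : (\sum_j z j) * (\sum_j a j * y j) <=
    k * ((\sum_j a j * z j) * (\sum_j y j)).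
  rewrite !big_distrlr /= mulr_sumr; apply: ler_sum => j _.
  rewrite mulr_sumr; apply: ler_sum => j' _.
  have := ler_wpM2r (mulr_ge0 (z0 j) (y0 j')) (hak j' j); lra.
have Y0 : 0 <= (\sum_j z j) * (\sum_j a j * y j).
  by apply: mulr_ge0; apply: sumr_ge0 => // j _; apply: mulr_ge0.
have := ler_wpM2l Y0 cross; lra.
Qed.

Section Smoothness.
Variables (R : realType) (n m : nat) (G : routing_instance R n m).
Variables (k : R) (hk : max_asymmetry G = k%:E).

(** AM-GM handles the slope parts. The offset on the left is absorbed by the [l] term because
    [1 <= l], and the offset in the [mu] term is nonnegative. *)
Lemma latency_smooth (l mu : R) (y z : 'M[R]_(n, m)) i :
  1 <= l -> 0 <= mu -> k <= 4 * l * mu ->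
  (forall j, 0 <= y i j) -> (forall j, 0 <= z i j) ->
  (\sum_j z i j) * latency G y i <=
  l * ((\sum_j z i j) * latency G z i) + mu * ((\sum_j y i j) * latency G y i).
Proof.
move=> l1 mu0 hlmu y0 z0.
have hsq := weighted_sum_sqr_le (slope_ge0 G i) y0 z0
  (slope_le_asymmetry hk i).
have S0 (w : 'M[R]_(n, m)) :
    (forall j, 0 <= w i j) -> 0 <= \sum_j w i j by move=> w0; apply: sumr_ge0.
have A0 (w : 'M[R]_(n, m)) : (forall j, 0 <= w i j) ->
    0 <= (\sum_j w i j) * (\sum_j slope G i j * w i j).
  move=> w0; apply: mulr_ge0; first exact: S0.
  by apply: sumr_ge0 => j _; rewrite mulr_ge0 ?slope_ge0.
have amgm := weighted_AMGM (le_trans ler01 l1) mu0 hlmu (A0 z z0) (A0 y y0) hsq.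
have bz := mulr_ge0 (S0 z z0) (offset_ge0 G i).
have by0 := mulr_ge0 mu0 (mulr_ge0 (S0 y y0) (offset_ge0 G i)).
have lbz := ler_wpM2r bz l1.
rewrite /latency; lra.
Qed.

Lemma equilibrium_cost_smooth (l mu : R) zhat z :
  1 <= l -> 0 <= mu -> k <= 4 * l * mu ->
  wardrop_equilibrium G zhat -> feasible_routing G z ->
  (1 - mu) * social_cost G zhat <= l * social_cost G z.
Proof.
move=> l1 mu0 hlmu eq_zhat fz.
rewrite mulrBl mul1r lerBlDr.
apply: le_trans (wardrop_variational eq_zhat fz) _.
rewrite !mulr_sumr -big_split; apply: ler_sum => i _.
case: fz => f ff ->; case: eq_zhat => fhat [ffhat -> _].
by apply: latency_smooth => // j; apply: edge_routing_ge0.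
Qed.

End Smoothness.

Theorem theorem2 (R : realType) (n m : nat) (G : routing_instance R n m)
    (k : R) (hk : max_asymmetry G = k%:E)
    (zhat zstar : 'M[R]_(n, m))
    (hzhat : wardrop_equilibrium G zhat)
    (hzstar : socially_optimal G zstar) :
  social_cost G zhat <= Lambda k * social_cost G zstar.
Proof.
have [fz _] := hzstar.
have k1 : 1 <= k by have := max_asymmetry_ge1 G; rewrite hk lee_fin.
have C0 : 0 <= social_cost G zstar.
  case: fz => f ff ->; apply: sumr_ge0 => i _; apply: mulr_ge0.
    by apply: sumr_ge0 => j _; apply: edge_routing_ge0.
  apply: addr_ge0 (offset_ge0 G i); apply: sumr_ge0 => j _.
  by rewrite mulr_ge0 ?slope_ge0 ?edge_routing_ge0.
rewrite /Lambda; case: (leP k 3) => k3.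
  have : (1 - k / 4) * social_cost G zhat <= 1 * social_cost G zstar.
    by apply: (equilibrium_cost_smooth hk) => //; lra.
  (* Here [k <= 3] makes [4 - k] positive, so the division is legitimate. *)
  by move=> h; rewrite mulrAC ler_pdivlMr; lra.
(* Here [k > 3] ensures [l = k / 2 >= 1], and [4 * l * mu] equals [k]. *)
have : (1 - 1 / 2) * social_cost G zhat <= k / 2 * social_cost G zstar.
  by apply: (equilibrium_cost_smooth hk) => //; lra.
have := mulr_ge0 (le_trans ler01 k1) C0; lra.
Qed.
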